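(* Let $Q$ be an operator on an algebra $R$. For a given $\omega=xy-(\phi(x)+y\psi(x))\in\Omega$ with $\phi,\psi\in\mathbf k[x]$, $Q$ has a unique coextension $\widehat Q^{\,\omega}:R^{\mathbb N}\to R^{\mathbb N}$ such that $\omega(\partial_R,\widehat Q^{\,\omega})=0$, that is, $$\partial_R\widehat Q^{\,\omega}=\phi(\partial_R)+\widehat Q^{\,\omega}\psi(\partial_R).$$ Thus the triple $(R^{\mathbb N},\partial_R,\widehat Q^{\,\omega})$ is a type $\omega$ operated differential algebra of weight $\lambda$.
   Context: $\mathbf k$ is a fixed commutative ring with identity and $\lambda\in\mathbf k$ is fixed. All algebras are commutative $\mathbf k$-algebras with identity and all operators are $\mathbf k$-linear. Products of operators are compositions; for $\phi\in\mathbf k[x]$ and an operator $q$, $\phi(q)$ is the usual evaluation (constant terms multiply the identity operator). A differential operator of weight $\lambda$ on $R$ is an operator $d$ with $d(xy)=d(x)y+xd(y)+\lambda d(x)d(y)$ for all $x,y\in R$ and $d(\mathbf 1_R)=0$; $(R,d)$ is then a differential algebra of weight $\lambda$. $\Omega=\{xy-(\phi(x)+y\psi(x))\mid\phi,\psi\in\mathbf k[x]\}\subset\mathbf k\langle x,y\rangle$ (noncommuting variables). For $\omega=xy-(\phi(x)+y\psi(x))$ and operators $q,Q$ on the same algebra, $\omega(q,Q)=0$ means $qQ=\phi(q)+Q\psi(q)$. A type $\omega$ operated differential algebra of weight $\lambda$ is a triple $(R,d,Q)$ with $(R,d)$ a differential algebra of weight $\lambda$, $Q$ an operator on $R$, and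 $\omega(d,Q)=0$. For an algebra $R$, $R^{\mathbb N}$ ($\mathbb N=\{0,1,2,\dots\}$) is the module of sequences $f=(f_n)_{n\in\mathbb N}$ in $R$ with product $(fg)_n=\sum_{k=0}^n\sum_{j=0}^{n-k}\binom nk\binom{n-k}{j}\lambda^kf_{n-j}g_{k+j}$, and $\partial_R(f)_n=f_{n+1}$, which is a differential operator of weight $\lambda$ on $R^{\mathbb N}$. A coextension of an operator $Q:R\to R$ to $R^{\mathbb N}$ is an operator $\widehat Q:R^{\mathbb N}\to R^{\mathbb N}$ with $\widehat Q(f)_0=Q(f_0)$ for all $f\in R^{\mathbb N}$. *)

(* Defs.v *)
From HB Require Import structures.
From mathcomp Require Import all_boot all_order all_algebra.
From mathcomp Require Import ssrAC.
From mathcomp Require Import boolp functions.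
Set Implicit Arguments.
Unset Strict Implicit.
Unset Printing Implicit Defensive.
Import GRing.Theory.
Local Open Scope ring_scope.

Section Operators.
Variables (k : comNzRingType) (A : comAlgType k).

Definition polyop (p : {poly k}) (q : A -> A) (x : A) : A :=
  \sum_(i < size p) p`_i *: iter i q x.

Definition differential_operator (lambda : k) (d : {linear A -> A}) : Prop :=
  (forall x y : A, d (x * y) = d x * y + x * d y + lambda *: (d x * d y))
  /\ d 1 = 0.

End Operators.

(* [OmegaPoly phi psi] stands for the noncommutative polynomial
   xy - (phi(x) + y psi(x)), which determines phi and psi. *)
Record Omega (k : comNzRingType) := OmegaPoly {
  omega_phi : {poly k};
  omega_psi : {poly k}
}.

Definition omega_vanishes (k : comNzRingType) (A : comAlgType k)
    (omega : Omega k) (q Q : {linear A -> A}) : Prop :=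
  forall x : A,
    q (Q x) = polyop (omega_phi omega) q x + Q (polyop (omega_psi omega) q x).

Definition operated_differential_algebra (k : comNzRingType) (lambda : k)
    (omega : Omega k) (A : comAlgType k) (d Q : {linear A -> A}) : Prop :=
  differential_operator lambda d /\ omega_vanishes omega d Q.

(* A copy of [nat -> R]: the pointwise product already carried by [nat -> R]
   is not the product of R^N, which moreover depends on lambda. *)
Definition hurwitz (k : comNzRingType) (lambda : k) (R : comAlgType k) : Type :=
  nat -> R.

HB.instance Definition _ (k : comNzRingType) (lambda : k) (R : comAlgType k) :=
  GRing.Lmodule.copy (hurwitz lambda R) (nat -> R).

Section HurwitzAlgebra.
Variables (k : comNzRingType) (lambda : k) (R : comAlgType k).
Local Notation H := (hurwitz lambda R).
Implicit Types f g h : H.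

Definition hurwitz_one : H := fun n => if n is 0 then 1 else 0.

Definition hurwitz_mul f g : H := fun n =>
  \sum_(i < n.+1) \sum_(j < (n - i).+1)
    (lambda ^+ i *: (f (n - j)%N * g (i + j)%N)) *+ ('C(n, i) * 'C(n - i, j)).

Definition hurwitz_shift f : H := fun n => f n.+1.

Local Notation "f ** g" := (hurwitz_mul f g) (at level 40).
Local Notation D := hurwitz_shift.

Lemma hurwitzP f g : (forall n, f n = g n) -> f = g.
Proof. by move=> fg; apply/funext. Qed.

Lemma hurwitz_addE f g n : (f + g) n = f n + g n.
Proof. by []. Qed.

Lemma hurwitz_scaleE (a : k) f n : (a *: f) n = a *: f n.
Proof. by []. Qed.

Lemma binomial_sumS (V : nmodType) (u : nat -> V) n :
  \sum_(i < n.+2) u i *+ 'C(n.+1, i) =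
  \sum_(i < n.+1) (u i + u i.+1) *+ 'C(n, i).
Proof.
rewrite big_ord_recl /= bin0.
under eq_bigr => i _ do rewrite /bump /= add1n binS mulrnDr.
rewrite big_split /= big_ord_recr /= (bin_small (ltnSn n)) mulr0n addr0.
rewrite addrA.
under [in RHS]eq_bigr => i _ do rewrite mulrnDl.
by rewrite [RHS]big_split /= [in RHS]big_ord_recl /= bin0.
Qed.

Lemma hurwitz_mul0 f g : (f ** g) 0 = f 0 * g 0.
Proof. by rewrite /hurwitz_mul !big_ord1 expr0 scale1r bin0 mulr1n. Qed.

Lemma hurwitz_mulE f g n : (f ** g) n =
  \sum_(i < n.+1) (\sum_(j < (n - i).+1)
    (lambda ^+ i *: (f (n - j)%N * g (i + j)%N)) *+ 'C(n - i, j)) *+ 'C(n, i).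
Proof.
apply: eq_bigr => i _; rewrite -sumrMnl.
by apply: eq_bigr => j _; rewrite mulnC mulrnA.
Qed.

Lemma hurwitz_mulS f g n : (f ** g) n.+1 =
  (D f ** g) n + (f ** D g) n + lambda *: (D f ** D g) n.
Proof.
rewrite !hurwitz_mulE (binomial_sumS (fun i => \sum_(j < (n.+1 - i).+1)
    (lambda ^+ i *: (f (n.+1 - j)%N * g (i + j)%N)) *+ 'C(n.+1 - i, j))).
rewrite scaler_sumr -!big_split /=; apply: eq_bigr => i _.
have le_in : (i <= n)%N by rewrite -ltnS.
rewrite -scalerMnr -!mulrnDl; congr (_ *+ _); congr (_ + _).
  rewrite subSn // (binomial_sumS (fun j =>
    lambda ^+ i *: (f (n.+1 - j)%N * g (i + j)%N))) -big_split /=.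
  apply: eq_bigr => j _; rewrite -mulrnDl /D subSS addnS subSn //.
  by rewrite (leq_trans _ (leq_subr i n)) // -ltnS.
rewrite subSS scaler_sumr; apply: eq_bigr => j _.
rewrite -scalerMnr scalerA -exprS /D addSn subSn //.
by rewrite (leq_trans _ (leq_subr i n)) // -ltnS.
Qed.

Lemma hurwitz_shift_is_linear : linear (D : H -> H).
Proof. by []. Qed.

HB.instance Definition _ :=
  GRing.isLinear.Build k H H *:%R D hurwitz_shift_is_linear.

Lemma hurwitz_shiftM f g :
  D (f ** g) = D f ** g + f ** D g + lambda *: (D f ** D g).
Proof. by apply: hurwitzP => n; exact: hurwitz_mulS. Qed.

Lemma hurwitz_mulDl : left_distributive hurwitz_mul +%R.
Proof.
move=> f g h; apply: hurwitzP => n; rewrite hurwitz_addE.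
rewrite /hurwitz_mul -big_split /=; apply: eq_bigr => i _.
rewrite -big_split /=; apply: eq_bigr => j _.
by rewrite -mulrnDl -scalerDr -mulrDl.
Qed.

Lemma hurwitz_mulC : commutative hurwitz_mul.
Proof.
move=> f g; apply: hurwitzP => n; elim: n f g => [|n IH] f g.
  by rewrite !hurwitz_mul0 mulrC.
rewrite !hurwitz_mulS (IH (D f) g) (IH f) (IH (D f) (D g)).
by congr (_ + _); exact: addrC.
Qed.

Lemma hurwitz_mulDr : right_distributive hurwitz_mul +%R.
Proof.
by move=> f g h; rewrite hurwitz_mulC hurwitz_mulDl !(hurwitz_mulC f).
Qed.

Lemma hurwitz_scaleAl (a : k) f g : a *: (f ** g) = (a *: f) ** g.
Proof.
apply: hurwitzP => n; rewrite hurwitz_scaleE /hurwitz_mul scaler_sumr.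
apply: eq_bigr => i _; rewrite scaler_sumr; apply: eq_bigr => j _.
by rewrite -scalerMnr scalerA mulrC -scalerA scalerAl.
Qed.

Lemma hurwitz_scaleAr (a : k) f g : a *: (f ** g) = f ** (a *: g).
Proof. by rewrite hurwitz_mulC hurwitz_scaleAl hurwitz_mulC. Qed.

Lemma hurwitz_mulA : associative hurwitz_mul.
Proof.
move=> f g h; apply: hurwitzP => n; elim: n f g h => [|n IH] f g h.
  by rewrite !hurwitz_mul0 mulrA.
rewrite !hurwitz_mulS !hurwitz_shiftM.
rewrite !(hurwitz_mulDl, hurwitz_mulDr) -!(hurwitz_scaleAl, hurwitz_scaleAr).
rewrite !(hurwitz_addE, hurwitz_scaleE) !IH !scalerDr.
by rewrite [LHS](AC (1*3*3) (1*2*5*3*(6*4*7))).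
Qed.

Lemma hurwitz_mul1 : left_id hurwitz_one hurwitz_mul.
Proof.
have D1 : D hurwitz_one = 0 by [].
have mul0 f : 0 ** f = 0.
  by rewrite -[X in X ** _](scale0r (0 : H)) -hurwitz_scaleAl scale0r.
move=> f; apply: hurwitzP => n; elim: n f => [|n IH] f.
  by rewrite hurwitz_mul0 mul1r.
by rewrite hurwitz_mulS D1 !mul0 IH [X in X + _ + _]/(0 : R) add0r scaler0 addr0.
Qed.

Lemma hurwitz_one_neq0 : hurwitz_one != 0.
Proof. by apply/eqP => /(congr1 (fun f => f 0%N)) /eqP; rewrite oner_eq0. Qed.

HB.instance Definition _ := GRing.Zmodule_isComNzRing.Build H
  hurwitz_mulA hurwitz_mulC hurwitz_mul1 hurwitz_mulDl hurwitz_one_neq0.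

HB.instance Definition _ := GRing.Lmodule_isLalgebra.Build k H hurwitz_scaleAl.

HB.instance Definition _ := GRing.Lalgebra_isComAlgebra.Build k H.

Definition coextension (Q : {linear R -> R}) (Qhat : {linear H -> H}) : Prop :=
  forall f, Qhat f 0%N = Q (f 0%N).

End HurwitzAlgebra.

(* Main.v *)
(** Read at index [n], the equation
    [d (Qhat f) = phi(d) f + Qhat (psi(d) f)] expresses the entry [n.+1] of
    [Qhat f] through the entry [n] of [Qhat] at another sequence, while the
    coextension condition prescribes the entry [0].  So the two conditions
    are precisely a recursive definition of [Qhat]. *)
Require Import Defs.
From HB Require Import structures.
From mathcomp Require Import all_boot all_order all_algebra.
Import GRing.Theory.
Local Open Scope ring_scope.

(** Powers of a linear operator are linear, and commutativity of [k] lets scalars pass the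
    coefficients of [p]. *)
Lemma polyop_is_linear (k : comNzRingType) (A : comAlgType k) (p : {poly k})
    (q : {linear A -> A}) : linear (polyop p q).
Proof.
have iter_linear i : linear (iter i q).
  by elim: i => [//|i IH] a x y; rewrite !iterS IH linearP.
move=> a x y; rewrite /polyop scaler_sumr -big_split /=.
apply: eq_bigr => i _.
by rewrite iter_linear scalerDr !scalerA [a * _]mulrC.
Qed.

Section OmegaCoextension.
Context {k : comNzRingType} {lambda : k} {R : comAlgType k}.
Variables (Q : {linear R -> R}) (phi psi : {poly k}).
Local Notation H := (hurwitz lambda R).
Local Notation d := (@hurwitz_shift k lambda R : {linear H -> H}).

(** The recursion is structural in the index, while the sequence changes from [f] to
    [polyop psi d f] at each step. *)
Fixpoint omega_coext_entry (n : nat) (f : H) : R :=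
  if n is m.+1 then
    polyop phi d f m + omega_coext_entry m (polyop psi d f)
  else Q (f 0%N).

Definition omega_coext (f : H) : H := fun n => omega_coext_entry n f.

Lemma omega_coext_is_linear : linear omega_coext.
Proof.
move=> a f g; apply: hurwitzP => n.
rewrite hurwitz_addE hurwitz_scaleE /omega_coext.
(* Both sequences stay general, since the induction hypothesis is applied to their images under
   [polyop psi d]. *)
elim: n f g => [|n IH] f g /=.
  by rewrite hurwitz_addE hurwitz_scaleE linearP.
rewrite !polyop_is_linear hurwitz_addE hurwitz_scaleE IH scalerDr.
by rewrite addrACA.
Qed.

HB.instance Definition _ :=
  GRing.isLinear.Build k H H *:%R omega_coext omega_coext_is_linear.

Lemma coextension_unique (Q1 Q2 : {linear H -> H}) :
  coextension Q Q1 -> omega_vanishes (OmegaPoly phi psi) d Q1 ->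
  coextension Q Q2 -> omega_vanishes (OmegaPoly phi psi) d Q2 -> Q1 =1 Q2.
Proof.
move=> ext1 om1 ext2 om2 f; apply: hurwitzP => n.
elim: n f => [|n IH] f; first by rewrite ext1 ext2.
(* At index [n] the two equations give the entries [n.+1] of [Q1 f] and [Q2 f]; their last terms
   agree by [IH] at [polyop psi d f]. *)
have /(congr1 (fun h : H => h n)) := om1 f.
have /(congr1 (fun h : H => h n)) := om2 f.
by rewrite /= !hurwitz_addE IH => <-.
Qed.

End OmegaCoextension.

Lemma hurwitz_shift_differential (k : comNzRingType) (lambda : k)
    (R : comAlgType k) :
  differential_operator lambda
    (@hurwitz_shift k lambda R : {linear hurwitz lambda R -> hurwitz lambda R}).
Proof. by split=> // f g; exact: hurwitz_shiftM. Qed.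

Theorem proposition2p6 (k : comNzRingType) (lambda : k) (R : comAlgType k)
    (Q : {linear R -> R}) (phi psi : {poly k}) :
  let omega := OmegaPoly phi psi in
  let d : {linear hurwitz lambda R -> hurwitz lambda R} :=
    @hurwitz_shift k lambda R in
  exists Qhat : {linear hurwitz lambda R -> hurwitz lambda R},
    [/\ coextension Q Qhat,
        omega_vanishes omega d Qhat,
        forall Qhat' : {linear hurwitz lambda R -> hurwitz lambda R},
          coextension Q Qhat' -> omega_vanishes omega d Qhat' -> Qhat' =1 Qhat
      & operated_differential_algebra lambda omega d Qhat].
Proof.
move=> omega d.
pose Qhat : {linear hurwitz lambda R -> hurwitz lambda R} :=
  omega_coext Q phi psi.
(* This and the next claim hold by computation: they are the two branches of [omega_coext_entry]. *)
have ext : coextension Q Qhat by [].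
have om : omega_vanishes omega d Qhat by [].
exists Qhat; split=> // [Q' ext' om'|].
  exact: (@coextension_unique _ _ _ Q phi psi).
by split=> //; exact: hurwitz_shift_differential.
Qed.
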